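(* Any algebraically coherent semi-abelian category $\mathcal{C}$ satisfies both of the following conditions: (SH) (''Smith is Huq'') any two equivalence relations on an object of $\mathcal{C}$ commute in the Smith sense as soon as their normalisations commute in the Huq sense; (NH) (normality of Higgins commutators of normal subobjects) for every object $X$ of $\mathcal{C}$ and all normal subobjects $K$, $L$ of $X$, the Higgins commutator $[K,L]\leq X$ is a normal subobject of $X$.
   Context: A category is semi-abelian if it is pointed, Barr exact, protomodular and has binary coproducts. A category is protomodular if it has pullbacks of split epimorphisms along any map and all change-of-base functors between its categories of points (defined below) reflect isomorphisms. A normal subobject is a kernel. A cospan $(f\colon X\to Z,\ g\colon Y\to Z)$ in a category with finite limits is jointly strongly epimorphic if every monomorphism into $Z$ through which both $f$ and $g$ factor is an isomorphism. A functor between categories with finite limits is coherent if it preserves finite limits and jointly strongly epimorphic pairs. $\mathsf{Pt}_X(\mathcal{C})$ is the category of points over $X$: objects are triples $(A,\ p\colon A\to X,\ s\colon X\to A)$ with $ps=1_X$, and morphisms are morphisms between the objects $A$ commuting with the $p$'s and the $s$'s. For $f\colon X\to Y$, the change-of-base functor $f^*\colon \mathsf{Pt}_Y(\mathcal{C})\to\mathsf{Pt}_X(\mathcal{C})$ is pulling back along $f$. A category $\mathcal{C}$ with finite limits is algebraically coherent if $f^*$ is coherent for every morphism $f$ of $\mathcal{C}$. Huq commutation: two morphisms $k\colon K\to X$, $l\colon L\to X$ commute in the Huq sense if there is a morphism $\varphi\colon K\times L\to X$ with $\varphi\langle 1_K,0\rangle=k$ and $\varphi\langle 0,1_L\rangle=l$.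 Smith commutation: equivalence relations $(R,r_1,r_2)$ and $(S,s_1,s_2)$ on $X$ (with reflexivity maps $\Delta_R\colon X\to R$, $\Delta_S\colon X\to S$) commute in the Smith sense (centralise each other) if there is a morphism $\theta\colon R\times_X S\to X$, where $R\times_X S$ is the pullback of $r_2$ and $s_1$, such that $\theta\langle 1_R,\Delta_S r_2\rangle=r_1$ and $\theta\langle\Delta_R s_1,1_S\rangle=s_2$. The normalisation of $R$ is the monomorphism $r_2\circ\ker(r_1)$ into $X$. Higgins commutator: for morphisms $k\colon K\to X$, $l\colon L\to X$, let $\iota_{K,L}\colon K\diamond L\to K+L$ be the kernel of the canonical morphism $\sigma_{K,L}\colon K+L\to K\times L$. The Higgins commutator $[K,L]\leq X$ is the regular image of the composite of $\iota_{K,L}$ with the morphism $K+L\to X$ induced by $k$ and $l$. *)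

(* Defs.v *)
(* Categories have Leibniz equality on hom types.  Limits and colimits are
   described by their universal properties; the pullbacks used by the
   change-of-base functors are chosen with [constructive_indefinite_description]. *)
From Stdlib Require Import List ProofIrrelevance IndefiniteDescription Description.

Set Implicit Arguments.
Unset Strict Implicit.
Unset Printing Implicit Defensive.

Declare Scope cat_scope.
Open Scope cat_scope.

(** * Categories and functors *)

Record category := Category {
  ob :> Type;
  hom : ob -> ob -> Type;
  idm : forall X, hom X X;
  comp : forall X Y Z, hom Y Z -> hom X Y -> hom X Z;
  comp_assoc : forall X Y Z W (h : hom Z W) (g : hom Y Z) (f : hom X Y),
    comp h (comp g f) = comp (comp h g) f;
  comp_idl : forall X Y (f : hom X Y), comp (idm Y) f = f;
  comp_idr : forall X Y (f : hom X Y), comp f (idm X) = f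
}.

Arguments hom {c} X Y.
Arguments idm {c} X.
Arguments comp {c X Y Z} g f.

Notation "g ∘ f" := (comp g f) (at level 40, left associativity) : cat_scope.

Record functor (C D : category) := Functor {
  fob :> C -> D;
  fmap : forall X Y : C, hom X Y -> hom (fob X) (fob Y);
  fmap_id : forall X : C, fmap (idm X) = idm (fob X);
  fmap_comp : forall (X Y Z : C) (g : hom Y Z) (f : hom X Y),
    fmap (g ∘ f) = fmap g ∘ fmap f
}.

Arguments fmap {C D} _ {X Y} _.

Lemma functor_comp_id (C D E : category) (G : functor D E) (F : functor C D) (X : C) :
  fmap G (fmap F (idm X)) = idm (G (F X)).
Proof. now rewrite !fmap_id. Qed.

Lemma functor_comp_comp (C D E : category) (G : functor D E) (F : functor C D)
    (X Y Z : C) (g : hom Y Z) (f : hom X Y) :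
  fmap G (fmap F (g ∘ f)) = fmap G (fmap F g) ∘ fmap G (fmap F f).
Proof. now rewrite !fmap_comp. Qed.

Definition functor_comp (C D E : category) (G : functor D E) (F : functor C D) :
    functor C E :=
  {| fob := fun X => G (F X);
     fmap := fun X Y f => fmap G (fmap F f);
     fmap_id := functor_comp_id G F;
     fmap_comp := functor_comp_comp G F |}.

Definition is_iso (C : category) (X Y : C) (f : hom X Y) : Prop :=
  exists g : hom Y X, g ∘ f = idm X /\ f ∘ g = idm Y.

Definition is_mono (C : category) (X Y : C) (m : hom X Y) : Prop :=
  forall (T : C) (a b : hom T X), m ∘ a = m ∘ b -> a = b.

Definition reflects_isos (C D : category) (F : functor C D) : Prop :=
  forall (X Y : C) (f : hom X Y), is_iso (fmap F f) -> is_iso f.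

(** * Limits and colimits *)

Definition finite_type (T : Type) : Prop := exists s : list T, forall x, In x s.

Definition finite_category (J : category) : Prop :=
  finite_type J /\ forall i j : J, finite_type (hom i j).

Definition is_cone (J C : category) (D : functor J C) (L : C)
    (pi : forall j : J, hom L (D j)) : Prop :=
  forall (i j : J) (u : hom i j), fmap D u ∘ pi i = pi j.

Definition is_limit (J C : category) (D : functor J C) (L : C)
    (pi : forall j : J, hom L (D j)) : Prop :=
  is_cone pi /\
  forall (T : C) (t : forall j : J, hom T (D j)), is_cone t ->
    exists! h : hom T L, forall j, pi j ∘ h = t j.

Definition has_finite_limits (C : category) : Prop :=
  forall (J : category) (D : functor J C), finite_category J ->
    exists (L : C) (pi : forall j : J, hom L (D j)), is_limit pi.

Definition preserves_finite_limits (C D : category) (F : functor C D) : Prop :=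
  forall (J : category) (G : functor J C), finite_category J ->
  forall (L : C) (pi : forall j : J, hom L (G j)), is_limit pi ->
    is_limit (D := functor_comp F G) (fun j => fmap F (pi j)).

Definition is_pullback (C : category) (X Y Z P : C) (f : hom X Z) (g : hom Y Z)
    (p1 : hom P X) (p2 : hom P Y) : Prop :=
  f ∘ p1 = g ∘ p2 /\
  forall (T : C) (a : hom T X) (b : hom T Y), f ∘ a = g ∘ b ->
    exists! u : hom T P, p1 ∘ u = a /\ p2 ∘ u = b.

Definition is_product (C : category) (X Y P : C) (p1 : hom P X) (p2 : hom P Y) : Prop :=
  forall (T : C) (a : hom T X) (b : hom T Y),
    exists! u : hom T P, p1 ∘ u = a /\ p2 ∘ u = b.

Definition is_coproduct (C : category) (X Y S : C) (i1 : hom X S) (i2 : hom Y S) : Prop :=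
  forall (T : C) (a : hom X T) (b : hom Y T),
    exists! u : hom S T, u ∘ i1 = a /\ u ∘ i2 = b.

Definition has_binary_coproducts (C : category) : Prop :=
  forall X Y : C, exists (S : C) (i1 : hom X S) (i2 : hom Y S), is_coproduct i1 i2.

Definition is_coequalizer (C : category) (X Y Q : C) (f g : hom X Y) (q : hom Y Q) : Prop :=
  q ∘ f = q ∘ g /\
  forall (T : C) (t : hom Y T), t ∘ f = t ∘ g -> exists! u : hom Q T, u ∘ q = t.

Definition is_regular_epi (C : category) (X Y : C) (e : hom X Y) : Prop :=
  exists (W : C) (f g : hom W X), is_coequalizer f g e.

(** * The category of points and change of base *)

Record point (C : category) (X : C) := Point {
  pt_ob : C;
  pt_p : hom pt_ob X;
  pt_s : hom X pt_ob;
  pt_ps : pt_p ∘ pt_s = idm X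
}.

Definition point_hom (C : category) (X : C) (A B : point X) : Type :=
  {h : hom (pt_ob A) (pt_ob B) | pt_p B ∘ h = pt_p A /\ h ∘ pt_s A = pt_s B}.

Lemma point_hom_eq (C : category) (X : C) (A B : point X) (h k : point_hom A B) :
  proj1_sig h = proj1_sig k -> h = k.
Proof. destruct h, k; simpl; intros; now apply subset_eq_compat. Qed.

Definition point_id (C : category) (X : C) (A : point X) : point_hom A A :=
  exist _ (idm (pt_ob A)) (conj (comp_idr (pt_p A)) (comp_idl (pt_s A))).

Lemma point_comp_subproof (C : category) (X : C) (A B D : point X)
    (k : point_hom B D) (h : point_hom A B) :
  pt_p D ∘ (proj1_sig k ∘ proj1_sig h) = pt_p A /\
  (proj1_sig k ∘ proj1_sig h) ∘ pt_s A = pt_s D.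
Proof.
destruct h as [h [h1 h2]], k as [k [k1 k2]]; simpl.
now rewrite comp_assoc, k1, h1, <- comp_assoc, h2, k2.
Qed.

Definition point_comp (C : category) (X : C) (A B D : point X)
    (k : point_hom B D) (h : point_hom A B) : point_hom A D :=
  exist _ (proj1_sig k ∘ proj1_sig h) (point_comp_subproof k h).

Definition Pt (C : category) (X : C) : category.
Proof.
refine {| ob := point X; hom := @point_hom C X;
          idm := @point_id C X; comp := @point_comp C X |};
intros; apply point_hom_eq; simpl;
[apply comp_assoc | apply comp_idl | apply comp_idr].
Defined.

Definition has_split_epi_pullbacks (C : category) : Prop :=
  forall (X Y A : C) (f : hom X Y) (p : hom A Y), (exists s : hom Y A, p ∘ s = idm Y) ->
    exists (P : C) (p1 : hom P A) (p2 : hom P X), is_pullback p f p1 p2.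

Section ChangeOfBase.
Variables (C : category) (H : has_split_epi_pullbacks C) (X Y : C) (f : hom X Y).

Record point_pullback (A : point Y) := PointPullback {
  pb_ob : C;
  pb_1 : hom pb_ob (pt_ob A);
  pb_2 : hom pb_ob X;
  pb_is_pullback : is_pullback (pt_p A) f pb_1 pb_2
}.

Definition chosen_pullback (A : point Y) : point_pullback A :=
  let (P, HP) := constructive_indefinite_description _
                   (H f (ex_intro _ (pt_s A) (pt_ps A))) in
  let (p1, Hp1) := constructive_indefinite_description _ HP in
  let (p2, Hp2) := constructive_indefinite_description _ Hp1 in
  PointPullback Hp2.

Lemma base_section_subproof (A : point Y) :
  exists! u : hom X (pb_ob (chosen_pullback A)),
    pb_1 (chosen_pullback A) ∘ u = pt_s A ∘ f /\ pb_2 (chosen_pullback A) ∘ u = idm X.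
Proof.
apply (pb_is_pullback (chosen_pullback A)).
now rewrite comp_assoc, pt_ps, comp_idl, comp_idr.
Qed.

(* The map induced into the pullback by the section composed with [f] and the identity. *)
Definition base_section (A : point Y) : hom X (pb_ob (chosen_pullback A)) :=
  proj1_sig (constructive_definite_description _ (base_section_subproof A)).

Lemma base_sectionP (A : point Y) :
  pb_1 (chosen_pullback A) ∘ base_section A = pt_s A ∘ f /\
  pb_2 (chosen_pullback A) ∘ base_section A = idm X.
Proof. exact (proj2_sig (constructive_definite_description _ (base_section_subproof A))). Qed.

Definition base_point (A : point Y) : point X :=
  {| pt_ob := pb_ob (chosen_pullback A);
     pt_p := pb_2 (chosen_pullback A);
     pt_s := base_section A;
     pt_ps := proj2 (base_sectionP A) |}.

Lemma base_map_subproof (A B : point Y) (h : point_hom A B) :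
  exists! u : hom (pb_ob (chosen_pullback A)) (pb_ob (chosen_pullback B)),
    pb_1 (chosen_pullback B) ∘ u = proj1_sig h ∘ pb_1 (chosen_pullback A) /\
    pb_2 (chosen_pullback B) ∘ u = pb_2 (chosen_pullback A).
Proof.
apply (pb_is_pullback (chosen_pullback B)).
rewrite comp_assoc, (proj1 (proj2_sig h)).
exact (proj1 (pb_is_pullback (chosen_pullback A))).
Qed.

Definition base_map (A B : point Y) (h : point_hom A B) :
    hom (pb_ob (chosen_pullback A)) (pb_ob (chosen_pullback B)) :=
  proj1_sig (constructive_definite_description _ (base_map_subproof h)).

Lemma base_mapP (A B : point Y) (h : point_hom A B) :
  pb_1 (chosen_pullback B) ∘ base_map h = proj1_sig h ∘ pb_1 (chosen_pullback A) /\
  pb_2 (chosen_pullback B) ∘ base_map h = pb_2 (chosen_pullback A).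
Proof. exact (proj2_sig (constructive_definite_description _ (base_map_subproof h))). Qed.

Lemma chosen_pullback_ext (A : point Y) (T : C) (u v : hom T (pb_ob (chosen_pullback A))) :
  pb_1 (chosen_pullback A) ∘ u = pb_1 (chosen_pullback A) ∘ v ->
  pb_2 (chosen_pullback A) ∘ u = pb_2 (chosen_pullback A) ∘ v -> u = v.
Proof.
intros E1 E2.
destruct (pb_is_pullback (chosen_pullback A)) as [sq univ].
destruct (univ T (pb_1 (chosen_pullback A) ∘ v) (pb_2 (chosen_pullback A) ∘ v))
  as [w [_ uniq]].
- now rewrite !comp_assoc, sq.
- now transitivity w; [symmetry|]; apply uniq.
Qed.

Lemma base_point_hom_subproof (A B : point Y) (h : point_hom A B) :
  pt_p (base_point B) ∘ base_map h = pt_p (base_point A) /\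
  base_map h ∘ pt_s (base_point A) = pt_s (base_point B).
Proof.
destruct (base_mapP h) as [m1 m2].
destruct (base_sectionP A) as [a1 a2], (base_sectionP B) as [b1 b2].
split; [exact m2|].
apply chosen_pullback_ext; simpl; rewrite comp_assoc.
- rewrite m1, <- comp_assoc, a1, b1, comp_assoc.
  now rewrite (proj2 (proj2_sig h)).
- now rewrite m2, a2, b2.
Qed.

Definition base_point_hom (A B : point Y) (h : point_hom A B) :
    point_hom (base_point A) (base_point B) :=
  exist _ (base_map h) (base_point_hom_subproof h).

Definition change_of_base : functor (Pt Y) (Pt X).
Proof.
refine (@Functor (Pt Y) (Pt X) base_point base_point_hom _ _).
- intros A; apply point_hom_eq; simpl.
  destruct (base_mapP (point_id A)) as [m1 m2].
  apply chosen_pullback_ext.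
  + rewrite m1; simpl; now rewrite comp_idl, comp_idr.
  + now rewrite m2, comp_idr.
- intros A B D k h; apply point_hom_eq; simpl.
  destruct (base_mapP (point_comp k h)) as [m1 m2].
  destruct (base_mapP k) as [k1 k2], (base_mapP h) as [h1 h2].
  apply chosen_pullback_ext; rewrite comp_assoc.
  + rewrite k1, <- comp_assoc, h1, comp_assoc; exact m1.
  + rewrite k2, h2; exact m2.
Defined.

End ChangeOfBase.

(** * Semi-abelian and algebraically coherent categories *)

Definition is_zero_object (C : category) (Z : C) : Prop :=
  (forall X : C, exists! f : hom X Z, True) /\ (forall X : C, exists! f : hom Z X, True).

Definition pointed (C : category) : Prop := exists Z : C, is_zero_object Z.

Definition is_zero_morphism (C : category) (X Y : C) (f : hom X Y) : Prop :=
  exists Z : C, is_zero_object Z /\ exists (g : hom X Z) (h : hom Z Y), f = h ∘ g.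

Definition is_kernel (C : category) (K X Y : C) (f : hom X Y) (k : hom K X) : Prop :=
  is_zero_morphism (f ∘ k) /\
  forall (T : C) (t : hom T X), is_zero_morphism (f ∘ t) -> exists! u : hom T K, k ∘ u = t.

Definition is_normal (C : category) (K X : C) (k : hom K X) : Prop :=
  exists (Y : C) (f : hom X Y), is_kernel f k.

Record is_equivalence_relation (C : category) (R X : C) (r1 r2 : hom R X) : Prop := {
  eqrel_mono : forall (T : C) (a b : hom T R),
    r1 ∘ a = r1 ∘ b -> r2 ∘ a = r2 ∘ b -> a = b;
  eqrel_refl : exists d : hom X R, r1 ∘ d = idm X /\ r2 ∘ d = idm X;
  eqrel_sym : exists s : hom R R, r1 ∘ s = r2 /\ r2 ∘ s = r1;
  eqrel_trans : exists (P : C) (p1 p2 : hom P R), is_pullback r2 r1 p1 p2 /\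
    exists t : hom P R, r1 ∘ t = r1 ∘ p1 /\ r2 ∘ t = r2 ∘ p2
}.

Record regular_category (C : category) : Prop := {
  reg_limits : has_finite_limits C;
  reg_coequalizers : forall (X Y R : C) (f : hom X Y) (r1 r2 : hom R X),
    is_pullback f f r1 r2 -> exists (Q : C) (q : hom X Q), is_coequalizer r1 r2 q;
  reg_stable : forall (X Y Z P : C) (f : hom X Z) (g : hom Y Z)
    (p1 : hom P X) (p2 : hom P Y),
    is_pullback f g p1 p2 -> is_regular_epi f -> is_regular_epi p2
}.

Record barr_exact (C : category) : Prop := {
  exact_regular : regular_category C;
  exact_effective : forall (R X : C) (r1 r2 : hom R X), is_equivalence_relation r1 r2 ->
    exists (Y : C) (f : hom X Y), is_pullback f f r1 r2
}.

Definition protomodular (C : category) : Prop :=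
  exists H : has_split_epi_pullbacks C,
  forall (X Y : C) (f : hom X Y), reflects_isos (change_of_base H f).

Record semi_abelian (C : category) : Prop := {
  sab_pointed : pointed C;
  sab_exact : barr_exact C;
  sab_protomodular : protomodular C;
  sab_coproducts : has_binary_coproducts C
}.

Definition jointly_strongly_epi (C : category) (X Y Z : C)
    (f : hom X Z) (g : hom Y Z) : Prop :=
  forall (M : C) (m : hom M Z), is_mono m ->
    (exists f' : hom X M, m ∘ f' = f) -> (exists g' : hom Y M, m ∘ g' = g) -> is_iso m.

Definition coherent (C D : category) (F : functor C D) : Prop :=
  preserves_finite_limits F /\
  forall (X Y Z : C) (f : hom X Z) (g : hom Y Z),
    jointly_strongly_epi f g -> jointly_strongly_epi (fmap F f) (fmap F g).

(* The witness [H] always exists when [C] has finite limits. *)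
Definition algebraically_coherent (C : category) : Prop :=
  has_finite_limits C /\
  exists H : has_split_epi_pullbacks C,
  forall (X Y : C) (f : hom X Y), coherent (change_of_base H f).

(** * Commutators *)

(* [i1] and [i2] are the maps <1,0> and <0,1> into the product. *)
Definition huq_commute (C : category) (K L X : C) (k : hom K X) (l : hom L X) : Prop :=
  exists (P : C) (p1 : hom P K) (p2 : hom P L) (i1 : hom K P) (i2 : hom L P),
    is_product p1 p2 /\
    p1 ∘ i1 = idm K /\ is_zero_morphism (p2 ∘ i1) /\
    is_zero_morphism (p1 ∘ i2) /\ p2 ∘ i2 = idm L /\
    exists phi : hom P X, phi ∘ i1 = k /\ phi ∘ i2 = l.

(* [dR] and [dS] are the reflexivity maps, [i] is <1_R, dS r2> and [j] is <dR s1, 1_S>. *)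
Definition smith_commute (C : category) (R S X : C)
    (r1 r2 : hom R X) (s1 s2 : hom S X) : Prop :=
  exists (dR : hom X R) (dS : hom X S) (P : C) (p1 : hom P R) (p2 : hom P S)
         (i : hom R P) (j : hom S P),
    (r1 ∘ dR = idm X /\ r2 ∘ dR = idm X) /\
    (s1 ∘ dS = idm X /\ s2 ∘ dS = idm X) /\
    is_pullback r2 s1 p1 p2 /\
    (p1 ∘ i = idm R /\ p2 ∘ i = dS ∘ r2) /\
    (p1 ∘ j = dR ∘ s1 /\ p2 ∘ j = idm S) /\
    exists theta : hom P X, theta ∘ i = r1 /\ theta ∘ j = s2.

Definition is_normalisation (C : category) (R X N : C) (r1 r2 : hom R X) (n : hom N X) :
    Prop :=
  exists k : hom N R, is_kernel r1 k /\ n = r2 ∘ k.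

Definition is_regular_image (C : category) (X Y I : C) (f : hom X Y) (m : hom I Y) : Prop :=
  is_mono m /\ exists e : hom X I, is_regular_epi e /\ f = m ∘ e.

(* [m] represents the subobject [K,L] of [X].  Here [S] is K + L, [P] is K x L,
   [sigma] is the canonical comparison and [c] is the copairing of [k] and [l]. *)
Definition is_higgins_commutator (C : category) (K L X I : C)
    (k : hom K X) (l : hom L X) (m : hom I X) : Prop :=
  exists (S : C) (i1 : hom K S) (i2 : hom L S) (P : C) (p1 : hom P K) (p2 : hom P L)
         (sigma : hom S P) (D : C) (iota : hom D S) (c : hom S X),
    is_coproduct i1 i2 /\
    is_product p1 p2 /\
    (p1 ∘ (sigma ∘ i1) = idm K /\ is_zero_morphism (p2 ∘ (sigma ∘ i1))) /\
    (is_zero_morphism (p1 ∘ (sigma ∘ i2)) /\ p2 ∘ (sigma ∘ i2) = idm L) /\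
    is_kernel sigma iota /\
    (c ∘ i1 = k /\ c ∘ i2 = l) /\
    is_regular_image (c ∘ iota) m.

Definition smith_is_huq (C : category) : Prop :=
  forall (X R S : C) (r1 r2 : hom R X) (s1 s2 : hom S X),
    is_equivalence_relation r1 r2 -> is_equivalence_relation s1 s2 ->
  forall (N M : C) (n : hom N X) (m : hom M X),
    is_normalisation r1 r2 n -> is_normalisation s1 s2 m ->
    huq_commute n m -> smith_commute r1 r2 s1 s2.

Definition normality_of_higgins (C : category) : Prop :=
  forall (X K L : C) (k : hom K X) (l : hom L X), is_normal k -> is_normal l ->
  forall (I : C) (m : hom I X), is_higgins_commutator k l m -> is_normal m.

(* Main.v *)
Require Import Defs.
From Stdlib Require Import ssreflect List.

(** Both conditions come from one construction in the category of points over [X].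

    A reflexive graph [R] on [X] is a point over [X] equipped with a morphism of points to
    the product [X x X] pointed by its diagonal.  Let [R] and [S] be two of them, let [Q]
    be their product as points, that is their fibred product over [X], and let [M] be the
    join of the images of [R] and [S] in the product of [Q] with [X x X]; its underlying
    object is a subobject of [Q x X].  If [M -> Q] is invertible, its inverse followed by
    [M -> X] is exactly a Smith multiplication on [R] and [S].  In any case the kernel [N]
    of [M -> Q] in the category of points has trivial component in [Q], so it embeds in
    [X x X]: it is a reflexive relation on [X], which plays the part of the commutator of
    [R] and [S].

    Now take kernels of points, that is, change the base along [0 -> X].  Let [K] and [L]
    be the kernels of [R] and [S], and [F] that of [M].  The pair [R -> M <- S] is jointly
    strongly epimorphic; by algebraic coherence so is [K -> F <- L]
    ([kernel_functor_coherent]).  Hence [F] is the join of [K] and [L] in [K x L x X], and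
    this makes both questions about [X] questions about [K] and [L].

    For Smith is Huq, suppose that [K] and [L] commute.  Then [F] is the graph of the
    multiplication [K x L -> X], so [F -> K x L] is invertible; by protomodularity
    [M -> Q] is invertible too ([fibred_join_iso]).

    For normality, take for [R] and [S] the kernel pairs of two morphisms with kernels [K]
    and [L].  The category has the Mal'tsev property, so the reflexive relation [N] is an
    equivalence relation, and by exactness it is the kernel pair of some [h].  Its
    normalisation is therefore the kernel of [h].  This normalisation is also the kernel of
    [F -> K x L], and since [K + L -> F] is a regular epimorphism it is the regular image
    of the kernel of [K + L -> K x L], which is the Higgins commutator
    ([relation_normalisation_higgins]). *)

Set Implicit Arguments.
Unset Strict Implicit.
Unset Printing Implicit Defensive.

(** * Composition, isomorphisms and universal properties *)

Lemma comp_pre (C : category) (X Y Z T : C) (g : hom Y Z) (f : hom X Y) (h : hom X Z)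
    (x : hom T X) : g ∘ f = h -> g ∘ (f ∘ x) = h ∘ x.
Proof. by move=> <-; rewrite comp_assoc. Qed.

Lemma comp_eq_pre (C : category) (X Y Y' Z T : C) (g : hom Y Z) (f : hom X Y)
    (g' : hom Y' Z) (f' : hom X Y') (x : hom T X) :
  g ∘ f = g' ∘ f' -> g ∘ (f ∘ x) = g' ∘ (f' ∘ x).
Proof. by rewrite !comp_assoc => ->. Qed.

Lemma is_iso_id (C : category) (X : C) : is_iso (idm X).
Proof. by exists (idm X); rewrite comp_idl. Qed.

Lemma mono_retract_iso (C : category) (X Y : C) (m : hom X Y) (g : hom Y X) :
  is_mono m -> m ∘ g = idm Y -> is_iso m.
Proof.
move=> mono_m mg; exists g; split=> //; apply: mono_m.
by rewrite (comp_pre _ mg) comp_idl comp_idr.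
Qed.

Definition joint_mono (C : category) (E X Y : C) (p : hom E X) (q : hom E Y) : Prop :=
  forall (T : C) (a b : hom T E), p ∘ a = p ∘ b -> q ∘ a = q ∘ b -> a = b.

Section UniversalProperties.
Context (C : category).

Lemma pullback_lift (X Y Z P T : C) (f : hom X Z) (g : hom Y Z) (p1 : hom P X)
    (p2 : hom P Y) (a : hom T X) (b : hom T Y) :
  is_pullback f g p1 p2 -> f ∘ a = g ∘ b -> exists u, p1 ∘ u = a /\ p2 ∘ u = b.
Proof. by move=> [_ univ] /univ [u [Eu _]]; exists u. Qed.

Lemma pullback_joint_mono (X Y Z P : C) (f : hom X Z) (g : hom Y Z) (p1 : hom P X)
    (p2 : hom P Y) : is_pullback f g p1 p2 -> joint_mono p1 p2.
Proof.
move=> [sq univ] T a b E1 E2.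
have [|w [_ uniq]] := univ T (p1 ∘ b) (p2 ∘ b); first exact: comp_eq_pre.
by rewrite -(uniq a) // -(uniq b).
Qed.

Lemma product_lift (X Y P T : C) (p1 : hom P X) (p2 : hom P Y) (a : hom T X)
    (b : hom T Y) : is_product p1 p2 -> exists u, p1 ∘ u = a /\ p2 ∘ u = b.
Proof. by move=> /(_ T a b) [u [Eu _]]; exists u. Qed.

Lemma product_joint_mono (X Y P : C) (p1 : hom P X) (p2 : hom P Y) :
  is_product p1 p2 -> joint_mono p1 p2.
Proof.
move=> univ T a b E1 E2; have [w [_ uniq]] := univ T (p1 ∘ b) (p2 ∘ b).
by rewrite -(uniq a) // -(uniq b).
Qed.

Lemma coproduct_lift (X Y S T : C) (i1 : hom X S) (i2 : hom Y S) (a : hom X T)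
    (b : hom Y T) : is_coproduct i1 i2 -> exists u, u ∘ i1 = a /\ u ∘ i2 = b.
Proof. by move=> /(_ T a b) [u [Eu _]]; exists u. Qed.

Lemma coproduct_ext (X Y S T : C) (i1 : hom X S) (i2 : hom Y S) (a b : hom S T) :
  is_coproduct i1 i2 -> a ∘ i1 = b ∘ i1 -> a ∘ i2 = b ∘ i2 -> a = b.
Proof.
move=> univ E1 E2; have [w [_ uniq]] := univ T (b ∘ i1) (b ∘ i2).
by rewrite -(uniq a) // -(uniq b).
Qed.

End UniversalProperties.

(** * Pullbacks from finite limits *)

(** The thin category shaped like a cospan, whose limits are pullbacks. *)
Inductive cospan_ob := cospan_left | cospan_right | cospan_apex.

Definition cospan_hom (i j : cospan_ob) : Set :=
  match i, j with
  | cospan_left, cospan_right | cospan_right, cospan_left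
  | cospan_apex, cospan_left | cospan_apex, cospan_right => Empty_set
  | _, _ => unit
  end.

Definition cospan_id (i : cospan_ob) : cospan_hom i i.
Proof. by case: i; exact tt. Defined.

Definition cospan_comp (i j k : cospan_ob) (v : cospan_hom j k) (u : cospan_hom i j) :
  cospan_hom i k.
Proof. by move: i j k v u => [] [] [] [] []; exact tt. Defined.

Lemma cospan_hom_eq (i j : cospan_ob) (u v : cospan_hom i j) : u = v.
Proof. by move: i j u v => [] [] [] []. Qed.

Definition cospan : category :=
  {| ob := cospan_ob; hom := cospan_hom; idm := cospan_id; comp := cospan_comp;
     comp_assoc := fun _ _ _ _ _ _ _ => cospan_hom_eq _ _;
     comp_idl := fun _ _ _ => cospan_hom_eq _ _;
     comp_idr := fun _ _ _ => cospan_hom_eq _ _ |}.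

Lemma cospan_finite : finite_category cospan.
Proof.
split; first by exists (cospan_left :: cospan_right :: cospan_apex :: nil) => -[] /=; auto.
by move=> [] []; first [exists nil; by case | exists (tt :: nil); case; left].
Qed.

Section CospanDiagram.
Context (C : category) (X Y Z : C) (f : hom X Z) (g : hom Y Z).

Definition cospan_value (i : cospan) : C :=
  match i with cospan_left => X | cospan_right => Y | cospan_apex => Z end.

Definition cospan_map (i j : cospan) : hom i j -> hom (cospan_value i) (cospan_value j) :=
  match i, j return cospan_hom i j -> hom (cospan_value i) (cospan_value j) with
  | cospan_left, cospan_left => fun _ => idm X
  | cospan_right, cospan_right => fun _ => idm Y
  | cospan_apex, cospan_apex => fun _ => idm Z
  | cospan_left, cospan_apex => fun _ => f
  | cospan_right, cospan_apex => fun _ => g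
  | cospan_left, cospan_right | cospan_right, cospan_left
  | cospan_apex, cospan_left | cospan_apex, cospan_right => fun u => match u with end
  end.

Definition cospan_diagram : functor cospan C.
Proof.
refine (@Functor cospan C cospan_value cospan_map _ _).
- by case.
- by move=> [] [] [] [] [] //=; rewrite ?comp_idl ?comp_idr.
Defined.

End CospanDiagram.

Definition has_pullbacks (C : category) : Prop :=
  forall (X Y Z : C) (f : hom X Z) (g : hom Y Z),
    exists (P : C) (p1 : hom P X) (p2 : hom P Y), is_pullback f g p1 p2.

Lemma finite_limits_pullbacks (C : category) : has_finite_limits C -> has_pullbacks C.
Proof.
move=> lim X Y Z f g.
have [L [pi [cone univ]]] := lim _ (cospan_diagram f g) cospan_finite.
have Ef : f ∘ pi cospan_left = pi cospan_apex := cone cospan_left cospan_apex tt.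
have Eg : g ∘ pi cospan_right = pi cospan_apex := cone cospan_right cospan_apex tt.
exists L, (pi cospan_left), (pi cospan_right); split; first by rewrite Ef Eg.
move=> T a b E.
pose t (j : cospan) : hom T (cospan_diagram f g j) :=
  match j return hom T (cospan_value X Y Z j) with
  | cospan_left => a | cospan_right => b | cospan_apex => f ∘ a
  end.
have [|h [Eh uniq]] := univ T t.
  by move=> [] [] [] /=; rewrite ?comp_idl.
exists h; split; first by split; [apply: (Eh cospan_left) | apply: (Eh cospan_right)].
move=> h' [E1 E2]; apply: uniq => -[] //=.
by rewrite -Ef -comp_assoc E1.
Qed.

(** * Regular images and joins *)

Lemma regular_epi_cancel (C : category) (X Y T : C) (e : hom X Y) (a b : hom Y T) :
  is_regular_epi e -> a ∘ e = b ∘ e -> a = b.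
Proof.
move=> [W [f [g [E univ]]]] Eab.
have [|w [_ uniq]] := univ T (b ∘ e); first by rewrite -!comp_assoc E.
by rewrite -(uniq a) // -(uniq b).
Qed.

(** If [e] is a coequaliser of [f] and [g] then its factor through the monomorphism [m]
    also identifies [f] and [g], and the map it induces is a section of [m]. *)
Lemma regular_epi_strong (C : category) (X Y M : C) (e : hom X Y) (m : hom M Y)
    (e' : hom X M) : is_regular_epi e -> is_mono m -> m ∘ e' = e -> is_iso m.
Proof.
move=> reg_e mono_m E; have [W [f [g [Efg univ]]]] := reg_e.
have [|s [Es _]] := univ M e'.
  by apply: mono_m; rewrite !(comp_pre _ E).
apply: (@mono_retract_iso _ _ _ _ s mono_m).
by apply: (regular_epi_cancel reg_e); rewrite -comp_assoc Es comp_idl.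
Qed.

Lemma regular_epi_iso_comp (C : category) (X Y Y' : C) (e : hom X Y) (m : hom Y Y') :
  is_regular_epi e -> is_iso m -> is_regular_epi (m ∘ e).
Proof.
move=> [W [f [g [E univ]]]] [n [nm mn]]; exists W, f, g; split.
  by rewrite -!comp_assoc E.
move=> T t /univ [u [Eu uniq]]; exists (u ∘ n); split.
  by rewrite -comp_assoc (comp_pre _ nm) comp_idl.
move=> v; rewrite comp_assoc => /uniq ->.
by rewrite -comp_assoc mn comp_idr.
Qed.

Section Regular.
Context (C : category) (reg : regular_category C).

Let pullbacks : has_pullbacks C := finite_limits_pullbacks (reg_limits reg).

(** The coequaliser [q] of the kernel pair of [f] works.  That its comparison with [f] is a
    monomorphism rests on the stability of [q] under pullback. *)
Lemma regular_image_exists (X Y : C) (f : hom X Y) :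
  exists (I : C) (m : hom I Y), is_regular_image f m.
Proof.
have [R [r1 [r2 pbR]]] := pullbacks f f.
have [I [q coeq]] := reg_coequalizers reg pbR.
have reg_q : is_regular_epi q by exists R, r1, r2.
have [Eq univ] := coeq.
have [m [Em _]] := univ Y f (proj1 pbR).
exists I, m; split; last by exists q.
move=> T a b Eab.
(* On a regular cover of [T] both maps lift along [q]; the lifts have the same image under
   [f], hence form a map to the kernel pair, and [q] identifies them. *)
have [P1 [x1 [t1 pb1]]] := pullbacks q a.
have [P2 [x2 [t2 pb2]]] := pullbacks q (b ∘ t1).
have reg1 := reg_stable reg pb1 reg_q.
have reg2 := reg_stable reg pb2 reg_q.
apply: (regular_epi_cancel reg1); apply: (regular_epi_cancel reg2).
rewrite -(proj1 pb2) -(proj1 pb1) -comp_assoc.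
have [|z [z1 z2]] := @pullback_lift _ _ _ _ _ _ _ _ _ _ (x1 ∘ t2) x2 pbR.
  rewrite -Em -!comp_assoc (proj1 pb2) !comp_assoc -(comp_assoc m) (proj1 pb1).
  by rewrite comp_assoc Eab.
by rewrite -z1 -z2; apply: comp_eq_pre.
Qed.

Lemma strong_epi_regular (X Y : C) (e : hom X Y) :
  (forall (M : C) (m : hom M Y) (e' : hom X M), is_mono m -> m ∘ e' = e -> is_iso m) ->
  is_regular_epi e.
Proof.
move=> strong; have [I [m [mono_m [q [reg_q E]]]]] := regular_image_exists e.
by rewrite E; apply: regular_epi_iso_comp => //; apply: (strong _ _ q).
Qed.

(** Coproduct inclusions followed by a regular epimorphism are jointly strongly
    epimorphic, so the regular image of the copairing of [f] and [g] serves as their join. *)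
Lemma join_exists (R S A : C) (f : hom R A) (g : hom S A) :
  has_binary_coproducts C ->
  exists (M : C) (m : hom M A) (f' : hom R M) (g' : hom S M),
    is_mono m /\ m ∘ f' = f /\ m ∘ g' = g /\ jointly_strongly_epi f' g'.
Proof.
move=> coprod; have [U [i1 [i2 cop]]] := coprod R S.
have [t [t1 t2]] := coproduct_lift f g cop.
have [M [m [mono_m [q [reg_q Eq]]]]] := regular_image_exists t.
exists M, m, (q ∘ i1), (q ∘ i2); rewrite !comp_assoc -Eq; do 3!split=> //.
move=> B n mono_n [f' Ef] [g' Eg].
have [z [z1 z2]] := coproduct_lift f' g' cop.
apply: (regular_epi_strong (e' := z) reg_q mono_n).
by apply: (coproduct_ext cop); rewrite -comp_assoc ?z1 ?z2.
Qed.

End Regular.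

(** Each regular epimorphism identifies the pair that the other one coequalises, because
    both have the same composite with a monomorphism. *)
Lemma regular_image_unique (C : category) (X Y I J : C) (m : hom I Y) (n : hom J Y)
    (d : hom X I) (e : hom X J) :
  is_mono m -> is_mono n -> is_regular_epi d -> is_regular_epi e -> m ∘ d = n ∘ e ->
  exists (i : hom I J) (j : hom J I), n ∘ i = m /\ m ∘ j = n.
Proof.
move=> mono_m mono_n reg_d reg_e E.
have [W [f [g [Ed univd]]]] := reg_d; have [W' [f' [g' [Ee unive]]]] := reg_e.
have [|i [Ei _]] := univd J e.
  by apply: mono_n; rewrite !comp_assoc -E -!comp_assoc Ed.
have [|j [Ej _]] := unive I d.
  by apply: mono_m; rewrite !comp_assoc E -!comp_assoc Ee.
exists i, j; split.
  by apply: (regular_epi_cancel reg_d); rewrite -comp_assoc Ei.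
by apply: (regular_epi_cancel reg_e); rewrite -comp_assoc Ej.
Qed.

(** * Zero morphisms and kernels *)

Section Zero.
Context (C : category).

Lemma zero_object_terminal (Z X : C) (f g : hom X Z) : is_zero_object Z -> f = g.
Proof. by move=> [/(_ X) [h [_ uniq]] _]; rewrite -(uniq f) // -(uniq g). Qed.

Lemma zero_object_initial (Z X : C) (f g : hom Z X) : is_zero_object Z -> f = g.
Proof. by move=> [_ /(_ X) [h [_ uniq]]]; rewrite -(uniq f) // -(uniq g). Qed.

Lemma zero_morphism_unique (X Y : C) (f g : hom X Y) :
  is_zero_morphism f -> is_zero_morphism g -> f = g.
Proof.
move=> [Z [HZ [f1 [f2 ->]]]] [Z' [HZ' [g1 [g2 ->]]]].
have [t _] := proj1 HZ' Z.
rewrite (zero_object_terminal g1 (t ∘ f1) HZ') (zero_object_initial f2 (g2 ∘ t) HZ).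
by rewrite comp_assoc.
Qed.

Lemma zero_morphism_post (X Y Z : C) (f : hom X Y) (g : hom Y Z) :
  is_zero_morphism f -> is_zero_morphism (g ∘ f).
Proof.
by move=> [O [HO [a [b ->]]]]; exists O; split=> //; exists a, (g ∘ b); rewrite comp_assoc.
Qed.

Lemma zero_morphism_pre (X Y Z : C) (f : hom X Y) (g : hom Y Z) :
  is_zero_morphism g -> is_zero_morphism (g ∘ f).
Proof.
by move=> [O [HO [a [b ->]]]]; exists O; split=> //; exists (a ∘ f), b; rewrite comp_assoc.
Qed.

Lemma zero_morphism_exists (X Y : C) : pointed C -> exists f : hom X Y, is_zero_morphism f.
Proof.
move=> [Z HZ]; have [a _] := proj1 HZ X; have [b _] := proj2 HZ Y.
by exists (b ∘ a), Z; split=> //; exists a, b.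
Qed.

Lemma mono_zero (T X Y : C) (m : hom X Y) (t : hom T X) :
  pointed C -> is_mono m -> is_zero_morphism (m ∘ t) -> is_zero_morphism t.
Proof.
move=> pt mono_m z; have [o zo] := zero_morphism_exists T X pt.
suff -> : t = o by [].
by apply/mono_m/zero_morphism_unique => //; apply: zero_morphism_post.
Qed.

Lemma kernel_lift (K X Y T : C) (f : hom X Y) (k : hom K X) (t : hom T X) :
  is_kernel f k -> is_zero_morphism (f ∘ t) -> exists u, k ∘ u = t.
Proof. by move=> [_ univ] /univ [u [Eu _]]; exists u. Qed.

Lemma kernel_mono (K X Y : C) (f : hom X Y) (k : hom K X) : is_kernel f k -> is_mono k.
Proof.
move=> [z univ] T a b E; have [|w [_ uniq]] := univ T (k ∘ b).
  by rewrite comp_assoc; apply: zero_morphism_pre.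
by rewrite -(uniq a) // -(uniq b).
Qed.

Lemma is_kernel_intro (K X Y : C) (f : hom X Y) (k : hom K X) :
  is_mono k -> is_zero_morphism (f ∘ k) ->
  (forall (T : C) (t : hom T X), is_zero_morphism (f ∘ t) -> exists u, k ∘ u = t) ->
  is_kernel f k.
Proof.
move=> mono_k z lift; split=> // T t /lift [u Eu]; exists u; split=> // v Ev.
by apply: mono_k; rewrite Eu.
Qed.

Lemma kernel_iso (K K' X Y : C) (f : hom X Y) (k : hom K X) (k' : hom K' X) :
  is_kernel f k -> is_kernel f k' ->
  exists (i : hom K K') (j : hom K' K),
    k' ∘ i = k /\ k ∘ j = k' /\ j ∘ i = idm K /\ i ∘ j = idm K'.
Proof.
move=> kerk kerk'.
have [i Ei] := kernel_lift kerk' (proj1 kerk); have [j Ej] := kernel_lift kerk (proj1 kerk').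
exists i, j; do 3!split=> //.
  by apply: (kernel_mono kerk); rewrite (comp_pre _ Ej) Ei comp_idr.
by apply: (kernel_mono kerk'); rewrite (comp_pre _ Ei) Ej comp_idr.
Qed.

Lemma pullback_zero_kernel (Z P X Y : C) (f : hom X Y) (o : hom Z Y) (k : hom P X)
    (t : hom P Z) : is_zero_object Z -> is_pullback f o k t -> is_kernel f k.
Proof.
move=> HZ pb; apply: is_kernel_intro.
- move=> T a b E; apply: (pullback_joint_mono pb) => //; exact: zero_object_terminal.
- by rewrite (proj1 pb); exists Z; split=> //; exists t, o.
- move=> T x zx; have [y _] := proj1 HZ T.
  have [|u [Eu _]] := pullback_lift (a := x) (b := y) pb; last by exists u.
  by apply: zero_morphism_unique => //; exists Z; split=> //; exists y, o.
Qed.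

Lemma kernel_exists (X Y : C) (f : hom X Y) :
  pointed C -> has_pullbacks C -> exists (K : C) (k : hom K X), is_kernel f k.
Proof.
move=> [Z HZ] pullbacks; have [o _] := proj2 HZ Y.
have [K [k [t pb]]] := pullbacks _ _ _ f o.
by exists K, k; apply: (pullback_zero_kernel HZ pb).
Qed.

Lemma product_exists (X Y : C) :
  pointed C -> has_pullbacks C ->
  exists (P : C) (p1 : hom P X) (p2 : hom P Y), is_product p1 p2.
Proof.
move=> [Z HZ] pullbacks; have [x _] := proj1 HZ X; have [y _] := proj1 HZ Y.
have [P [p1 [p2 [_ univ]]]] := pullbacks _ _ _ x y.
by exists P, p1, p2 => T a b; apply: univ; apply: zero_object_terminal.
Qed.

(** The equaliser of [a] and [b], built as the pullback of their pairing along a diagonal,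
    is a monomorphism through which both [f] and [g] factor. *)
Lemma jointly_strongly_epi_ext (X Y Z T : C) (f : hom X Z) (g : hom Y Z) (a b : hom Z T) :
  pointed C -> has_pullbacks C -> jointly_strongly_epi f g ->
  a ∘ f = b ∘ f -> a ∘ g = b ∘ g -> a = b.
Proof.
move=> pt pullbacks jse Ef Eg.
have [P [p1 [p2 prod]]] := product_exists T T pt pullbacks.
have [d [d1 d2]] := product_lift (idm T) (idm T) prod.
have [ab [ab1 ab2]] := product_lift a b prod.
have [E [e [t pb]]] := pullbacks _ _ _ ab d.
have Ea : a ∘ e = t by rewrite -ab1 -comp_assoc (proj1 pb) (comp_pre _ d1) comp_idl.
have Eb : b ∘ e = t by rewrite -ab2 -comp_assoc (proj1 pb) (comp_pre _ d2) comp_idl.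
have equalise W (x : hom W Z) : a ∘ x = b ∘ x -> exists x', e ∘ x' = x.
  move=> Ex; have [|x' [Ex' _]] := pullback_lift (a := x) (b := a ∘ x) pb.
    apply: (product_joint_mono prod); rewrite !comp_assoc.
      by rewrite ab1 d1 comp_idl.
    by rewrite ab2 d2 comp_idl.
  by exists x'.
have mono_e : is_mono e.
  move=> W x y Exy; apply: (pullback_joint_mono pb) => //.
  by rewrite -Ea -!comp_assoc Exy.
have [g' [_ eg']] := jse _ e mono_e (equalise _ f Ef) (equalise _ g Eg).
by rewrite -(comp_idr a) -(comp_idr b) -eg' !comp_assoc Ea Eb.
Qed.

End Zero.

(** * Protomodularity through kernels *)

Lemma chosen_pullback_kernel (C : category) (H : has_split_epi_pullbacks C) (Z X : C)
    (o : hom Z X) (A : point X) :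
  is_zero_object Z -> is_kernel (pt_p A) (pb_1 (chosen_pullback H o A)).
Proof. move=> HZ; exact: pullback_zero_kernel HZ (pb_is_pullback _). Qed.

(** The split short five lemma: base change along [0 -> X] is, up to the choice of
    kernels, the functor that sends a point to its kernel. *)
Lemma protomodular_kernel_iso (C : category) (X : C) (A B : point X) (h : point_hom A B)
    (K L : C) (k : hom K (pt_ob A)) (l : hom L (pt_ob B)) (u : hom K L) :
  pointed C -> protomodular C -> is_kernel (pt_p A) k -> is_kernel (pt_p B) l ->
  l ∘ u = proj1_sig h ∘ k -> is_iso u -> is_iso (proj1_sig h).
Proof.
move=> [Z HZ] [H refl] kerk kerl E [v [vu uv]].
have [o _] := proj2 HZ X.
have kerA := chosen_pullback_kernel H o A HZ; have kerB := chosen_pullback_kernel H o B HZ.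
have [iA [jA [iA1 [jA1 [jiA ijA]]]]] := kernel_iso kerk kerA.
have [iB [jB [iB1 [jB1 [jiB ijB]]]]] := kernel_iso kerl kerB.
have [b1 b2] := base_mapP H o h.
have Ebase : base_map H o h = iB ∘ (u ∘ jA).
  apply: (kernel_mono kerB).
  by rewrite b1 (comp_pre _ iB1) (comp_pre _ E) -comp_assoc jA1.
suff /refl [g [gh hg]] : is_iso (fmap (change_of_base H o) (h : @hom (Pt X) A B)).
  by exists (proj1_sig g); split; [have := f_equal (@proj1_sig _ _) gh
                                  | have := f_equal (@proj1_sig _ _) hg].
have Pg : pt_p (base_point H o A) ∘ (iA ∘ (v ∘ jB)) = pt_p (base_point H o B) /\
    (iA ∘ (v ∘ jB)) ∘ pt_s (base_point H o B) = pt_s (base_point H o A).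
  by split; [apply: zero_object_terminal | apply: zero_object_initial].
exists (exist _ _ Pg : point_hom (base_point H o B) (base_point H o A)).
split; apply: point_hom_eq; rewrite /= Ebase -!comp_assoc.
  by rewrite (comp_pre _ jiB) comp_idl (comp_pre _ vu) comp_idl ijA.
by rewrite (comp_pre _ jiA) comp_idl (comp_pre _ uv) comp_idl ijB.
Qed.

(** A subobject containing both the section and the kernel is again a point over [X], with
    the same kernel, so the split short five lemma applies. *)
Lemma split_extension_jointly_strongly_epi (C : category) (X A K : C) (p : hom A X)
    (s : hom X A) (k : hom K A) :
  pointed C -> protomodular C -> p ∘ s = idm X -> is_kernel p k ->
  jointly_strongly_epi s k.
Proof.
move=> pt proto ps kerk M m mono_m [s' Es] [k' Ek].
have ps' : (p ∘ m) ∘ s' = idm X by rewrite -comp_assoc Es.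
pose PM : point X := Point ps'; pose PA : point X := Point ps.
have Pm : pt_p PA ∘ m = pt_p PM /\ m ∘ pt_s PM = pt_s PA by [].
apply: (@protomodular_kernel_iso C X PM PA (exist _ m Pm) K K k' k (idm K)) => //=.
- apply: is_kernel_intro.
  + by move=> T a b E; apply: (kernel_mono kerk); rewrite -Ek -!comp_assoc E.
  + by rewrite -comp_assoc Ek; case: kerk.
  + move=> T t z; have [|u Eu] := kernel_lift (t := m ∘ t) kerk.
      by rewrite comp_assoc.
    by exists u; apply: mono_m; rewrite (comp_pre _ Ek).
- by rewrite comp_idr.
- exact: is_iso_id.
Qed.

(** * The Mal'tsev property *)

Lemma joint_mono_pair_mono (C : category) (N X Y P : C) (p1 : hom P X) (p2 : hom P Y)
    (n1 : hom N X) (n2 : hom N Y) (n : hom N P) :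
  joint_mono n1 n2 -> p1 ∘ n = n1 -> p2 ∘ n = n2 -> is_mono n.
Proof. by move=> jm E1 E2 T a b E; apply: jm; rewrite -?E1 -?E2 -!comp_assoc E. Qed.

(** Consider the object [G] of zigzags [x N y], [z N y], [z N w] as split over the object
    [E] of the pairs [x N y], [z N y] by the choice [w = y].  The zigzags with [x N w] form
    a subobject [T] of [G].  It contains the image of the splitting, since [x N y], and the
    kernel, where [x = y = z = 0] and [z N w] says that [x N w]; hence it is all of [G]. *)
Lemma reflexive_relation_difunctional (C : category) (N X : C) (n1 n2 : hom N X)
    (d : hom X N) :
  pointed C -> protomodular C -> has_pullbacks C ->
  joint_mono n1 n2 -> n1 ∘ d = idm X -> n2 ∘ d = idm X ->
  forall (W : C) (x y z : hom W N), n2 ∘ x = n2 ∘ y -> n1 ∘ y = n1 ∘ z ->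
    exists t : hom W N, n1 ∘ t = n1 ∘ x /\ n2 ∘ t = n2 ∘ z.
Proof.
move=> pt proto pullbacks jm n1d n2d W x y z Exy Eyz.
have [E [e1 [e2 pbE]]] := pullbacks _ _ _ n2 n2.
have [G [g [c pbG]]] := pullbacks _ _ _ (n1 ∘ e2) n1.
have [P [p1 [p2 prod]]] := product_exists X X pt pullbacks.
have [n [pn1 pn2]] := product_lift n1 n2 prod.
have [q [q1 q2]] := product_lift (n1 ∘ (e1 ∘ g)) (n2 ∘ c) prod.
have [T [m [t pbT]]] := pullbacks _ _ _ q n.
have mono_n : is_mono n by apply: (joint_mono_pair_mono jm pn1 pn2).
have mono_m : is_mono m.
  move=> V a b Em; apply: (pullback_joint_mono pbT) => //; apply: mono_n.
  by rewrite -!(comp_eq_pre _ (proj1 pbT)) Em.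
have in_T V (v : hom V G) (r : hom V N) :
    n1 ∘ r = n1 ∘ (e1 ∘ (g ∘ v)) -> n2 ∘ r = n2 ∘ (c ∘ v) -> exists v', m ∘ v' = v.
  move=> E1 E2; have [|v' [Ev _]] := pullback_lift (a := v) (b := r) pbT; last by exists v'.
  apply: (product_joint_mono prod).
    by rewrite (comp_pre _ q1) (comp_pre _ pn1) E1 -!comp_assoc.
  by rewrite (comp_pre _ q2) (comp_pre _ pn2) E2 -comp_assoc.
have [|s [gs cs]] := pullback_lift (a := idm E) (b := e2) pbG; first by rewrite comp_idr.
have [K [k kerk]] := kernel_exists g pt pullbacks.
have jse := split_extension_jointly_strongly_epi pt proto gs kerk.
have has_s : exists s', m ∘ s' = s.
  by apply: (in_T _ s e1); rewrite ?gs ?cs ?comp_idr //; case: pbE.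
have has_k : exists k', m ∘ k' = k.
  apply: (in_T _ k (c ∘ k)) => //.
  have zk : is_zero_morphism (g ∘ k) by case: kerk.
  have sqG : n1 ∘ (c ∘ k) = n1 ∘ (e2 ∘ (g ∘ k)).
    by rewrite -(comp_eq_pre _ (proj1 pbG)) -!comp_assoc.
  by rewrite sqG; apply: zero_morphism_unique; do 2!apply: zero_morphism_post.
have [m' [_ mm']] := jse T m mono_m has_s has_k.
have [a [a1 a2]] := pullback_lift pbE Exy.
have [|b [b1 b2]] := pullback_lift (a := a) (b := z) pbG; first by rewrite -comp_assoc a2.
exists (t ∘ (m' ∘ b)); split.
  rewrite -pn1 -!comp_assoc -(comp_eq_pre _ (proj1 pbT)) (comp_pre _ mm') comp_idl.
  by rewrite (comp_pre _ q1) (comp_pre _ pn1) -!comp_assoc b1 a1.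
rewrite -pn2 -!comp_assoc -(comp_eq_pre _ (proj1 pbT)) (comp_pre _ mm') comp_idl.
by rewrite (comp_pre _ q2) (comp_pre _ pn2) -!comp_assoc b2.
Qed.

(** Difunctionality applied to [y N y], [x N y], [x N x] gives symmetry, and applied to
    [x N y], [y N y], [y N w] it gives transitivity. *)
Lemma reflexive_relation_equivalence (C : category) (N X : C) (n1 n2 : hom N X)
    (d : hom X N) :
  pointed C -> protomodular C -> has_pullbacks C ->
  joint_mono n1 n2 -> n1 ∘ d = idm X -> n2 ∘ d = idm X ->
  is_equivalence_relation n1 n2.
Proof.
move=> pt proto pullbacks jm n1d n2d.
have difun := reflexive_relation_difunctional pt proto pullbacks jm n1d n2d.
split=> //; first by exists d.
  have [||t [t1 t2]] := difun _ (d ∘ n2) (idm N) (d ∘ n1);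
    rewrite ?(comp_pre _ n1d) ?(comp_pre _ n2d) ?comp_idl ?comp_idr //.
  by exists t; rewrite t1 t2 (comp_pre _ n1d) (comp_pre _ n2d) !comp_idl.
have [P [p1 [p2 pb]]] := pullbacks _ _ _ n2 n1.
exists P, p1, p2; split=> //.
by apply: (difun _ p1 (d ∘ (n2 ∘ p1)) p2);
  rewrite ?(comp_pre _ n1d) ?(comp_pre _ n2d) comp_idl //; case: pb.
Qed.

Lemma kernel_pair_normalisation (C : category) (N X Y V : C) (h : hom X Y)
    (n1 n2 : hom N X) (v : hom V N) :
  pointed C -> is_pullback h h n1 n2 -> is_kernel n2 v -> is_kernel h (n1 ∘ v).
Proof.
move=> pt pb kerv; have zv : is_zero_morphism (n2 ∘ v) by case: kerv.
apply: is_kernel_intro.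
- move=> T a b; rewrite -!comp_assoc => E; apply: (kernel_mono kerv).
  apply: (pullback_joint_mono pb) => //; rewrite !comp_assoc.
  by apply: zero_morphism_unique; apply: zero_morphism_pre.
- by rewrite (comp_eq_pre _ (proj1 pb)); apply: zero_morphism_post.
- move=> T t zt; have [o zo] := zero_morphism_exists T X pt.
  have [|u [u1 u2]] := pullback_lift (a := t) (b := o) pb.
    by apply: zero_morphism_unique => //; apply: zero_morphism_post.
  have [|w Ew] := kernel_lift (t := u) kerv; first by rewrite u2.
  by exists w; rewrite -comp_assoc Ew.
Qed.

(** * Coherence of the kernel functors *)

(** The kernel pair of [h] is itself a point over [X], so [h] can be tested on it. *)
Lemma mono_of_point_mono (C : category) (X : C) (A B : point X) (h : point_hom A B) :
  has_pullbacks C -> is_mono (h : @hom (Pt X) A B) -> is_mono (proj1_sig h).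
Proof.
move=> pullbacks mono_h T a b E.
have [P [p1 [p2 pb]]] := pullbacks _ _ _ (proj1_sig h) (proj1_sig h).
have [|d [d1 d2]] := pullback_lift (a := pt_s A) (b := pt_s A) pb => //.
have hp := proj1 (proj2_sig h).
have pd : (pt_p A ∘ p1) ∘ d = idm X by rewrite -comp_assoc d1 pt_ps.
have p21 : pt_p A ∘ p2 = pt_p A ∘ p1.
  by rewrite -hp -!comp_assoc -(proj1 pb).
pose PP : point X := Point pd.
have H1 : pt_p A ∘ p1 = pt_p PP /\ p1 ∘ pt_s PP = pt_s A by [].
have H2 : pt_p A ∘ p2 = pt_p PP /\ p2 ∘ pt_s PP = pt_s A by [].
pose f1 : @hom (Pt X) PP A := exist _ p1 H1; pose f2 : @hom (Pt X) PP A := exist _ p2 H2.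
have Ef : @comp (Pt X) _ _ _ h f1 = @comp (Pt X) _ _ _ h f2 by apply: point_hom_eq; case: pb.
have E12 : p1 = p2 := f_equal (@proj1_sig _ _) (mono_h PP f1 f2 Ef).
by have [u [<- <-]] := pullback_lift pb E; rewrite E12.
Qed.

(** This is the only use of algebraic coherence, for the morphism [0 -> X].  It transfers to
    arbitrary kernels because the category of points over [0] is the category itself: all
    maps over [0] respect projections and sections. *)
Lemma kernel_functor_coherent (C : category) (X : C) (A B M : point X)
    (f : point_hom A M) (g : point_hom B M) (K L F : C) (k : hom K (pt_ob A))
    (l : hom L (pt_ob B)) (m : hom F (pt_ob M)) (u : hom K F) (v : hom L F) :
  pointed C -> algebraically_coherent C ->
  is_kernel (pt_p A) k -> is_kernel (pt_p B) l -> is_kernel (pt_p M) m ->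
  m ∘ u = proj1_sig f ∘ k -> m ∘ v = proj1_sig g ∘ l ->
  jointly_strongly_epi (proj1_sig f) (proj1_sig g) -> jointly_strongly_epi u v.
Proof.
move=> [Z HZ] [lim [H coh]] kerk kerl kerm Eu Ev jse.
have pullbacks := finite_limits_pullbacks lim.
have [o _] := proj2 HZ X.
have jsePt : jointly_strongly_epi (f : @hom (Pt X) A M) (g : @hom (Pt X) B M).
  move=> D d /(mono_of_point_mono pullbacks) mono_d [f' Ef] [g' Eg].
  have Ff : exists f'', proj1_sig d ∘ f'' = proj1_sig f.
    by exists (proj1_sig f'); rewrite -Ef.
  have Fg : exists g'', proj1_sig d ∘ g'' = proj1_sig g.
    by exists (proj1_sig g'); rewrite -Eg.
  have [e [ed de]] := jse _ _ mono_d Ff Fg.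
  have He : pt_p D ∘ e = pt_p M /\ e ∘ pt_s M = pt_s D.
    have [dp ds] := proj2_sig d.
    by split; [rewrite -dp -comp_assoc de comp_idr
              | rewrite -ds comp_assoc ed comp_idl].
  by exists (exist _ e He); split; apply: point_hom_eq.
have jseZ := proj2 (coh _ _ o) _ _ _ _ _ jsePt.
have kerA := chosen_pullback_kernel H o A HZ; have kerB := chosen_pullback_kernel H o B HZ.
have kerM := chosen_pullback_kernel H o M HZ.
have [iA [jA [iA1 [jA1 _]]]] := kernel_iso kerk kerA.
have [iB [jB [iB1 [jB1 _]]]] := kernel_iso kerl kerB.
have [iM [jM [iM1 [jM1 [jiM ijM]]]]] := kernel_iso kerm kerM.
move=> D d mono_d [u' Eu'] [v' Ev'].
have [tD _] := proj1 HZ D; have [sD _] := proj2 HZ D.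
have ps : tD ∘ sD = idm Z by apply: zero_object_terminal.
pose PD : point Z := Point ps.
have point_map (A' B' : point Z) (a : hom (pt_ob A') (pt_ob B')) :
    pt_p B' ∘ a = pt_p A' /\ a ∘ pt_s A' = pt_s B'.
  by split; [apply: zero_object_terminal | apply: zero_object_initial].
pose d' : point_hom PD (base_point H o M) := exist _ (iM ∘ d) (point_map _ _ _).
have mono_d' : is_mono (d' : @hom (Pt Z) PD (base_point H o M)).
  move=> T a b /(f_equal (@proj1_sig _ _)) /= E; apply/point_hom_eq/mono_d.
  by apply: (kernel_mono kerm); rewrite -iM1 -!comp_assoc !(comp_assoc iM) E.
have Ff : exists f' : @hom (Pt Z) (base_point H o A) PD,
    @comp (Pt Z) _ _ _ d' f' = fmap (change_of_base H o) f.
  exists (exist _ (u' ∘ jA) (point_map (base_point H o A) PD _)).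
  apply/point_hom_eq/(kernel_mono kerM) => /=.
  rewrite (proj1 (base_mapP H o f)) -!comp_assoc (comp_pre _ Eu') (comp_pre _ iM1).
  by rewrite (comp_pre _ Eu) -comp_assoc jA1.
have Fg : exists g' : @hom (Pt Z) (base_point H o B) PD,
    @comp (Pt Z) _ _ _ d' g' = fmap (change_of_base H o) g.
  exists (exist _ (v' ∘ jB) (point_map (base_point H o B) PD _)).
  apply/point_hom_eq/(kernel_mono kerM) => /=.
  rewrite (proj1 (base_mapP H o g)) -!comp_assoc (comp_pre _ Ev') (comp_pre _ iM1).
  by rewrite (comp_pre _ Ev) -comp_assoc jB1.
have [e [ed de]] := jseZ PD d' mono_d' Ff Fg.
have Ed : iM ∘ (d ∘ proj1_sig e) = idm _.
  by rewrite comp_assoc; exact: (f_equal (@proj1_sig _ _) de).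
apply: (mono_retract_iso (g := proj1_sig e ∘ iM) mono_d).
by rewrite -(comp_idl (d ∘ _)) -{1}jiM -!comp_assoc !(comp_assoc d) (comp_pre _ Ed) comp_idl.
Qed.

(** * The join of two reflexive graphs in their fibred product *)

(** A reflexive graph on [X] is regarded as a point over [X] through [rg_base], together
    with a morphism of points, with second component [rg_base] and first component
    [rg_other], to the product [X x X] pointed by its diagonal. *)
Record reflexive_graph (C : category) (X : C) := ReflexiveGraph {
  rg_ob : C;
  rg_base : hom rg_ob X;
  rg_other : hom rg_ob X;
  rg_unit : hom X rg_ob;
  rg_base_unit : rg_base ∘ rg_unit = idm X;
  rg_other_unit : rg_other ∘ rg_unit = idm X
}.

Definition rg_point (C : category) (X : C) (R : reflexive_graph X) : point X :=
  Point (rg_base_unit R).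

(** For reflexive graphs [R] and [S] with fibred product [Q] over [X], the subobject [M]
    of [Q x X] represented by [fj_pair] and [fj_other] is the join, in the category of
    points over [X], of the images of [R] and [S] in the product of [Q] with [X x X].  The
    remaining fields describe the kernel [fj_ker] of [M -> X] inside [P x X], where [P] is
    the product of the kernels [k] and [l] of [R] and [S]. *)
Record fibred_join (C : category) (X : C) (R S : reflexive_graph X)
    (K L Q P : C) (k : hom K (rg_ob R)) (l : hom L (rg_ob S))
    (q1 : hom Q (rg_ob R)) (q2 : hom Q (rg_ob S)) (p1 : hom P K) (p2 : hom P L) :=
  FibredJoin {
  fj_ob : C;
  fj_pair : hom fj_ob Q;
  fj_other : hom fj_ob X;
  fj_left : hom (rg_ob R) fj_ob;
  fj_right : hom (rg_ob S) fj_ob;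
  fj_joint_mono : joint_mono fj_pair fj_other;
  fj_left1 : q1 ∘ (fj_pair ∘ fj_left) = idm (rg_ob R);
  fj_left2 : q2 ∘ (fj_pair ∘ fj_left) = rg_unit S ∘ rg_base R;
  fj_left_other : fj_other ∘ fj_left = rg_other R;
  fj_right1 : q1 ∘ (fj_pair ∘ fj_right) = rg_unit R ∘ rg_base S;
  fj_right2 : q2 ∘ (fj_pair ∘ fj_right) = idm (rg_ob S);
  fj_right_other : fj_other ∘ fj_right = rg_other S;
  fj_ker_ob : C;
  fj_ker : hom fj_ker_ob fj_ob;
  fj_ker_kernel : is_kernel (rg_base R ∘ (q1 ∘ fj_pair)) fj_ker;
  fj_ker_left : hom K fj_ker_ob;
  fj_ker_right : hom L fj_ker_ob;
  fj_ker_leftE : fj_ker ∘ fj_ker_left = fj_left ∘ k;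
  fj_ker_rightE : fj_ker ∘ fj_ker_right = fj_right ∘ l;
  fj_ker_jse : jointly_strongly_epi fj_ker_left fj_ker_right;
  fj_ker_pair : hom fj_ker_ob P;
  fj_ker_pair1 : k ∘ (p1 ∘ fj_ker_pair) = q1 ∘ (fj_pair ∘ fj_ker);
  fj_ker_pair2 : l ∘ (p2 ∘ fj_ker_pair) = q2 ∘ (fj_pair ∘ fj_ker)
}.

Arguments fj_joint_mono {C X R S K L Q P k l q1 q2 p1 p2} J : rename.
Arguments fj_ker_jse {C X R S K L Q P k l q1 q2 p1 p2} J : rename.

Section FibredJoin.
Context (C : category) (sab : semi_abelian C) (ac : algebraically_coherent C).

Let pt : pointed C := sab_pointed sab.
Let proto : protomodular C := sab_protomodular sab.
Let reg : regular_category C := exact_regular (sab_exact sab).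
Let pullbacks : has_pullbacks C := finite_limits_pullbacks (reg_limits reg).

Context (X : C) (R S : reflexive_graph X) (K L Q P : C).
Context (k : hom K (rg_ob R)) (l : hom L (rg_ob S)).
Context (q1 : hom Q (rg_ob R)) (q2 : hom Q (rg_ob S)) (p1 : hom P K) (p2 : hom P L).
Context (kerk : is_kernel (rg_base R) k) (kerl : is_kernel (rg_base S) l).
Context (pbQ : is_pullback (rg_base R) (rg_base S) q1 q2) (prodP : is_product p1 p2).

Lemma fibred_join_exists : inhabited (fibred_join k l q1 q2 p1 p2).
Proof.
have [A [a1 [a2 prodA]]] := product_exists Q X pt pullbacks.
have [|iR [iR1 iR2]] := pullback_lift (a := idm (rg_ob R)) (b := rg_unit S ∘ rg_base R) pbQ.
  by rewrite (comp_pre _ (rg_base_unit S)) comp_idl comp_idr.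
have [|iS [iS1 iS2]] := pullback_lift (a := rg_unit R ∘ rg_base S) (b := idm (rg_ob S)) pbQ.
  by rewrite (comp_pre _ (rg_base_unit R)) comp_idl comp_idr.
have [f [f1 f2]] := product_lift iR (rg_other R) prodA.
have [g [g1 g2]] := product_lift iS (rg_other S) prodA.
have [M [m [jR [jS [mono_m [mR [mS jse]]]]]]] := join_exists reg f g (sab_coproducts sab).
have pairR : (a1 ∘ m) ∘ jR = iR by rewrite -comp_assoc mR.
have pairS : (a1 ∘ m) ∘ jS = iS by rewrite -comp_assoc mS.
have otherR : (a2 ∘ m) ∘ jR = rg_other R by rewrite -comp_assoc mR.
have otherS : (a2 ∘ m) ∘ jS = rg_other S by rewrite -comp_assoc mS.
have jm : joint_mono (a1 ∘ m) (a2 ∘ m).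
  by move=> T x y; rewrite -!comp_assoc => E1 E2; apply/mono_m/(product_joint_mono prodA).
have units : jR ∘ rg_unit R = jS ∘ rg_unit S.
  apply: jm; rewrite !comp_assoc ?pairR ?pairS ?otherR ?otherS.
    apply: (pullback_joint_mono pbQ); rewrite !comp_assoc ?iR1 ?iR2 ?iS1 ?iS2.
      by rewrite -!comp_assoc (rg_base_unit S) comp_idl comp_idr.
    by rewrite -!comp_assoc (rg_base_unit R) comp_idl comp_idr.
  by rewrite !rg_other_unit.
pose b := rg_base R ∘ (q1 ∘ (a1 ∘ m)).
have bR : b ∘ jR = rg_base R.
  by rewrite /b -!(comp_assoc (rg_base R)) -!(comp_assoc q1) pairR iR1 comp_idr.
have bS : b ∘ jS = rg_base S.
  rewrite /b -!(comp_assoc (rg_base R)) -!(comp_assoc q1) pairS iS1.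
  by rewrite (comp_pre _ (rg_base_unit R)) comp_idl.
have bM : b ∘ (jR ∘ rg_unit R) = idm X by rewrite (comp_pre _ bR) rg_base_unit.
have [F [kappa kerF]] := kernel_exists b pt pullbacks.
have [|u Eu] := kernel_lift (t := jR ∘ k) kerF.
  by rewrite (comp_pre _ bR); case: kerk.
have [|v Ev] := kernel_lift (t := jS ∘ l) kerF.
  by rewrite (comp_pre _ bS); case: kerl.
have HR : pt_p (Point bM) ∘ jR = pt_p (rg_point R) /\ jR ∘ pt_s (rg_point R) = pt_s (Point bM).
  by [].
have HS : pt_p (Point bM) ∘ jS = pt_p (rg_point S) /\ jS ∘ pt_s (rg_point S) = pt_s (Point bM).
  by split; rewrite //= units.
have jseF : jointly_strongly_epi u v.
  exact: (@kernel_functor_coherent C X (rg_point R) (rg_point S) (Point bM)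
           (exist _ jR HR) (exist _ jS HS) _ _ _ k l kappa).
have zF : is_zero_morphism (b ∘ kappa) by case: kerF.
have [|w1 Ew1] := kernel_lift (t := q1 ∘ ((a1 ∘ m) ∘ kappa)) kerk.
  by move: zF; rewrite /b -!comp_assoc.
have [|w2 Ew2] := kernel_lift (t := q2 ∘ ((a1 ∘ m) ∘ kappa)) kerl.
  by rewrite -(comp_eq_pre _ (proj1 pbQ)); move: zF; rewrite /b -!comp_assoc.
have [w [Ew1' Ew2']] := product_lift w1 w2 prodP.
constructor; refine (@FibredJoin C X R S K L Q P k l q1 q2 p1 p2 M (a1 ∘ m) (a2 ∘ m) jR jS
  jm _ _ otherR _ _ otherS F kappa kerF u v Eu Ev jseF w _ _); congruence.
Qed.

Context (J : fibred_join k l q1 q2 p1 p2).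

Lemma fj_ker_other_left : fj_other J ∘ (fj_ker J ∘ fj_ker_left J) = rg_other R ∘ k.
Proof. by rewrite fj_ker_leftE (comp_pre _ (fj_left_other J)). Qed.

Lemma fj_ker_other_right : fj_other J ∘ (fj_ker J ∘ fj_ker_right J) = rg_other S ∘ l.
Proof. by rewrite fj_ker_rightE (comp_pre _ (fj_right_other J)). Qed.

Lemma fj_ker_left1 : p1 ∘ (fj_ker_pair J ∘ fj_ker_left J) = idm K.
Proof.
apply: (kernel_mono kerk); rewrite comp_idr (comp_assoc p1) comp_assoc fj_ker_pair1.
rewrite -!comp_assoc fj_ker_leftE (comp_assoc (fj_pair J)) comp_assoc fj_left1.
by rewrite comp_idl.
Qed.

Lemma fj_ker_left2 : is_zero_morphism (p2 ∘ (fj_ker_pair J ∘ fj_ker_left J)).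
Proof.
apply: (mono_zero (m := l) pt (kernel_mono kerl)).
rewrite (comp_assoc p2) comp_assoc fj_ker_pair2 -!comp_assoc fj_ker_leftE.
rewrite (comp_assoc (fj_pair J)) comp_assoc fj_left2 -comp_assoc.
by apply: zero_morphism_post; case: kerk.
Qed.

Lemma fj_ker_right1 : is_zero_morphism (p1 ∘ (fj_ker_pair J ∘ fj_ker_right J)).
Proof.
apply: (mono_zero (m := k) pt (kernel_mono kerk)).
rewrite (comp_assoc p1) comp_assoc fj_ker_pair1 -!comp_assoc fj_ker_rightE.
rewrite (comp_assoc (fj_pair J)) comp_assoc fj_right1 -comp_assoc.
by apply: zero_morphism_post; case: kerl.
Qed.

Lemma fj_ker_right2 : p2 ∘ (fj_ker_pair J ∘ fj_ker_right J) = idm L.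
Proof.
apply: (kernel_mono kerl); rewrite comp_idr (comp_assoc p2) comp_assoc fj_ker_pair2.
rewrite -!comp_assoc fj_ker_rightE (comp_assoc (fj_pair J)) comp_assoc fj_right2.
by rewrite comp_idl.
Qed.

Lemma fj_ker_joint_mono : joint_mono (fj_ker_pair J) (fj_other J ∘ fj_ker J).
Proof.
move=> T x y E1; rewrite -!comp_assoc => E2.
apply: (kernel_mono (fj_ker_kernel J)); apply: (fj_joint_mono J) => //.
apply: (pullback_joint_mono pbQ).
  by rewrite (comp_assoc (fj_pair J)) comp_assoc -fj_ker_pair1 -!comp_assoc E1
             (comp_assoc p1) comp_assoc fj_ker_pair1 -!comp_assoc.
by rewrite (comp_assoc (fj_pair J)) comp_assoc -fj_ker_pair2 -!comp_assoc E1
           (comp_assoc p2) comp_assoc fj_ker_pair2 -!comp_assoc.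
Qed.

Definition fj_unit : hom X (fj_ob J) := fj_left J ∘ rg_unit R.

Lemma fj_base_unit : (rg_base R ∘ (q1 ∘ fj_pair J)) ∘ fj_unit = idm X.
Proof.
rewrite /fj_unit -!comp_assoc (comp_assoc (fj_pair J)) (comp_assoc q1) fj_left1 comp_idl.
exact: rg_base_unit.
Qed.

Lemma fj_other_unit : fj_other J ∘ fj_unit = idm X.
Proof. by rewrite (comp_pre _ (fj_left_other J)) rg_other_unit. Qed.

(** * Smith is Huq *)

(** If the kernels commute then the map [F -> P] is invertible: [F] lies in the graph of
    the multiplication [phi], because that graph contains [K] and [L], so [F -> P] is a
    monomorphism, while its image contains both factors of [P].  Since [F -> P] is the
    kernel part of [M -> Q], protomodularity makes [M -> Q] invertible as well. *)
Lemma fibred_join_iso (i1 : hom K P) (i2 : hom L P) (phi : hom P X) :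
  p1 ∘ i1 = idm K -> is_zero_morphism (p2 ∘ i1) ->
  is_zero_morphism (p1 ∘ i2) -> p2 ∘ i2 = idm L ->
  phi ∘ i1 = rg_other R ∘ k -> phi ∘ i2 = rg_other S ∘ l ->
  is_iso (fj_pair J).
Proof.
move=> p1i1 zp2i1 zp1i2 p2i2 phi1 phi2.
have w1 : fj_ker_pair J ∘ fj_ker_left J = i1.
  apply: (product_joint_mono prodP); first by rewrite fj_ker_left1.
  by apply: zero_morphism_unique => //; apply: fj_ker_left2.
have w2 : fj_ker_pair J ∘ fj_ker_right J = i2.
  apply: (product_joint_mono prodP); last by rewrite fj_ker_right2.
  by apply: zero_morphism_unique => //; apply: fj_ker_right1.
have in_graph : phi ∘ fj_ker_pair J = fj_other J ∘ fj_ker J.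
  apply: (jointly_strongly_epi_ext pt pullbacks (fj_ker_jse J)); rewrite -!comp_assoc.
    by rewrite w1 fj_ker_other_left.
  by rewrite w2 fj_ker_other_right.
have mono_w : is_mono (fj_ker_pair J).
  by move=> T x y E; apply: fj_ker_joint_mono; rewrite // -in_graph -!comp_assoc E.
have ker_i2 : is_kernel p1 i2.
  apply: is_kernel_intro => // [T x y E|T t zt].
    by rewrite -(comp_idl x) -p2i2 -comp_assoc E (comp_pre _ p2i2) comp_idl.
  exists (p2 ∘ t); apply: (product_joint_mono prodP).
    apply: zero_morphism_unique => //; rewrite comp_assoc; exact: zero_morphism_pre.
  by rewrite (comp_pre _ p2i2) comp_idl.
have iso_w : is_iso (fj_ker_pair J).
  apply: (split_extension_jointly_strongly_epi pt proto p1i1 ker_i2) => //.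
    by exists (fj_ker_left J).
  by exists (fj_ker_right J).
have [|j [j1 j2]] := pullback_lift (a := k ∘ p1) (b := l ∘ p2) pbQ.
  by apply: zero_morphism_unique; rewrite comp_assoc; apply: zero_morphism_pre;
    [case: kerk | case: kerl].
have kerj : is_kernel (rg_base R ∘ q1) j.
{ apply: is_kernel_intro.
  - move=> T x y E; apply: (product_joint_mono prodP).
      by apply: (kernel_mono kerk); rewrite !(comp_assoc k) -j1 -!comp_assoc E.
    by apply: (kernel_mono kerl); rewrite !(comp_assoc l) -j2 -!comp_assoc E.
  - by rewrite -comp_assoc j1 comp_assoc; apply: zero_morphism_pre; case: kerk.
  - move=> T t; rewrite -comp_assoc => zt.
    have [x Ex] := kernel_lift kerk zt.
    have [|y Ey] := kernel_lift (t := q2 ∘ t) kerl.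
      by rewrite -(comp_eq_pre _ (proj1 pbQ)).
    have [z [z1 z2]] := product_lift x y prodP.
    exists z; apply: (pullback_joint_mono pbQ).
      by rewrite (comp_pre _ j1) -comp_assoc z1.
    by rewrite (comp_pre _ j2) -comp_assoc z2. }
have Qs : (rg_base R ∘ q1) ∘ (fj_pair J ∘ fj_unit) = idm X.
  by rewrite -fj_base_unit -!comp_assoc.
have Hpair : pt_p (Point Qs) ∘ fj_pair J = pt_p (Point fj_base_unit) /\
    fj_pair J ∘ pt_s (Point fj_base_unit) = pt_s (Point Qs).
  by rewrite /= -comp_assoc.
apply: (protomodular_kernel_iso (A := Point fj_base_unit) (B := Point Qs)
  (h := exist _ _ Hpair) pt proto (fj_ker_kernel J) kerj _ iso_w).
apply: (pullback_joint_mono pbQ) => /=.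
  by rewrite (comp_pre _ j1) -comp_assoc fj_ker_pair1.
by rewrite (comp_pre _ j2) -comp_assoc fj_ker_pair2.
Qed.

(** * The commutator relation *)

(** The kernel [N] of [M -> Q] among the points over [X].  As [M] lies in [Q x X], and the
    component of [N] in [Q] is determined by its base point, [N] lies in [X x X]. *)
Lemma fibred_join_relation :
  exists (N : C) (nu : hom N (fj_ob J)) (n2 : hom N X),
    is_pullback (fj_pair J) (fj_pair J ∘ fj_unit) nu n2 /\
    is_equivalence_relation (fj_other J ∘ nu) n2.
Proof.
have [N [nu [n2 pb]]] := pullbacks (fj_pair J) (fj_pair J ∘ fj_unit).
exists N, nu, n2; split=> //.
have [|d [d1 d2]] := pullback_lift (a := fj_unit) (b := idm X) pb.
  by rewrite comp_idr.
apply: (@reflexive_relation_equivalence C N X _ _ d) => //.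
- move=> T x y; rewrite -!comp_assoc => E1 E2; apply: (pullback_joint_mono pb) => //.
  by apply: (fj_joint_mono J) => //; rewrite !(comp_eq_pre _ (proj1 pb)) E2.
- by rewrite -comp_assoc d1 fj_other_unit.
Qed.

(** Since [K] and [L] are jointly strongly epimorphic in [F], the comparison [K + L -> F] is a
    regular epimorphism.  It lies over [P], the product of [K] and [L], so the map it
    induces between the kernels of [K + L -> P] and of [F -> P] is a pullback of it, hence
    a regular epimorphism as well.  The kernel of [F -> P] is [V], the normalisation of the
    relation [N], and it embeds in [X]: this is a regular image factorisation of the
    morphism defining the Higgins commutator. *)
Lemma relation_normalisation_higgins (N V U I D : C) (nu : hom N (fj_ob J)) (n2 : hom N X)
    (v : hom V N) (i1 : hom K U) (i2 : hom L U) (sigma : hom U P) (iota : hom D U)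
    (c : hom U X) (m : hom I X) :
  is_pullback (fj_pair J) (fj_pair J ∘ fj_unit) nu n2 -> is_kernel n2 v ->
  is_coproduct i1 i2 ->
  p1 ∘ (sigma ∘ i1) = idm K -> is_zero_morphism (p2 ∘ (sigma ∘ i1)) ->
  is_zero_morphism (p1 ∘ (sigma ∘ i2)) -> p2 ∘ (sigma ∘ i2) = idm L ->
  is_kernel sigma iota -> c ∘ i1 = rg_other R ∘ k -> c ∘ i2 = rg_other S ∘ l ->
  is_regular_image (c ∘ iota) m -> is_mono (fj_other J ∘ (nu ∘ v)) ->
  exists (i : hom I V) (j : hom V I),
    (fj_other J ∘ (nu ∘ v)) ∘ i = m /\ m ∘ j = fj_other J ∘ (nu ∘ v).
Proof.
move=> pbN kerv cop s11 s12 s21 s22 keri c1 c2 [mono_m [e' [reg_e' Em]]] mono_v.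
have zv : is_zero_morphism (n2 ∘ v) by case: kerv.
have [e [e1 e2]] := coproduct_lift (fj_ker_left J) (fj_ker_right J) cop.
have reg_e : is_regular_epi e.
  apply: (strong_epi_regular reg) => M' n f mono_n Ef.
  by apply: (fj_ker_jse J) mono_n _ _;
    [exists (f ∘ i1) | exists (f ∘ i2)]; rewrite comp_assoc Ef.
have Esigma : fj_ker_pair J ∘ e = sigma.
{ apply: (coproduct_ext cop); rewrite -comp_assoc ?e1 ?e2;
    apply: (product_joint_mono prodP).
  - by rewrite fj_ker_left1 s11.
  - by apply: zero_morphism_unique => //; apply: fj_ker_left2.
  - by apply: zero_morphism_unique => //; apply: fj_ker_right1.
  - by rewrite fj_ker_right2 s22. }
have Ec : c = fj_other J ∘ (fj_ker J ∘ e).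
  apply: (coproduct_ext cop); rewrite -!comp_assoc ?e1 ?e2.
    by rewrite c1 fj_ker_other_left.
  by rewrite c2 fj_ker_other_right.
(* [V] embeds in [F] by [f], and [F -> P] vanishes on it because its two components, after
   the monomorphisms [k] and [l], are those of [M -> Q]. *)
have z_pair : is_zero_morphism (fj_pair J ∘ (nu ∘ v)).
  by rewrite (comp_eq_pre _ (proj1 pbN)) -comp_assoc; do 2!apply: zero_morphism_post.
have [|f Ef] := kernel_lift (t := nu ∘ v) (fj_ker_kernel J).
  by rewrite -!comp_assoc; do 2!apply: zero_morphism_post.
have zf : is_zero_morphism (fj_ker_pair J ∘ f).
  have [o zo] := zero_morphism_exists V P pt.
  suff -> : fj_ker_pair J ∘ f = o by [].
  apply: (product_joint_mono prodP).
    apply/(kernel_mono kerk)/zero_morphism_unique; last by do 2!apply: zero_morphism_post.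
    rewrite (comp_assoc p1) comp_assoc fj_ker_pair1 -!comp_assoc Ef.
    exact: zero_morphism_post.
  apply/(kernel_mono kerl)/zero_morphism_unique; last by do 2!apply: zero_morphism_post.
  rewrite (comp_assoc p2) comp_assoc fj_ker_pair2 -!comp_assoc Ef.
  exact: zero_morphism_post.
have zi : is_zero_morphism (sigma ∘ iota) by case: keri.
have [o zo] := zero_morphism_exists D X pt.
have z_D : is_zero_morphism (fj_pair J ∘ (fj_ker J ∘ (e ∘ iota))).
  have [o' zo'] := zero_morphism_exists D Q pt.
  suff -> : fj_pair J ∘ (fj_ker J ∘ (e ∘ iota)) = o' by [].
  have zw : is_zero_morphism (fj_ker_pair J ∘ (e ∘ iota)).
    by rewrite (comp_assoc _ e) Esigma.
  apply: (pullback_joint_mono pbQ).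
    rewrite (comp_assoc (fj_pair J)) (comp_assoc q1) -fj_ker_pair1 -!comp_assoc.
    by apply: zero_morphism_unique; [do 2!apply: zero_morphism_post | apply: zero_morphism_post].
  rewrite (comp_assoc (fj_pair J)) (comp_assoc q2) -fj_ker_pair2 -!comp_assoc.
  by apply: zero_morphism_unique; [do 2!apply: zero_morphism_post | apply: zero_morphism_post].
have [|x [x1 x2]] := pullback_lift (a := fj_ker J ∘ (e ∘ iota)) (b := o) pbN.
  by apply: zero_morphism_unique => //; apply: zero_morphism_post.
have [|rho Erho] := kernel_lift (t := x) kerv; first by rewrite x2.
have Ef_rho : f ∘ rho = e ∘ iota.
  by apply: (kernel_mono (fj_ker_kernel J)); rewrite (comp_pre _ Ef) -comp_assoc Erho.
have mono_f : is_mono f.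
  by move=> T y y' E; apply: mono_v; rewrite -Ef -!comp_assoc E.
have pb_rho : is_pullback e f iota rho.
  split=> // T a b Eab.
  have [|y Ey] := kernel_lift (t := a) keri.
    by rewrite -Esigma -comp_assoc Eab comp_assoc; apply: zero_morphism_pre.
  exists y; split; first split=> //.
    by apply: mono_f; rewrite (comp_pre _ Ef_rho) -comp_assoc Ey.
  by move=> y' [Ey' _]; apply: (kernel_mono keri); rewrite Ey.
have reg_rho : is_regular_epi rho by apply: (reg_stable reg pb_rho).
have [|i [j [Ei Ej]]] := regular_image_unique mono_m mono_v reg_e' reg_rho.
  by rewrite -Em Ec -!comp_assoc Erho x1.
by exists i, j.
Qed.

End FibredJoin.

(** * The two conditions *)

Lemma kernel_of_iso (C : category) (X Y V I : C) (h : hom X Y) (n : hom V X) (m : hom I X)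
    (i : hom I V) (j : hom V I) :
  is_kernel h n -> is_mono m -> n ∘ i = m -> m ∘ j = n -> is_kernel h m.
Proof.
move=> kern mono_m Ei Ej; apply: is_kernel_intro => // [|T t zt].
  by rewrite -Ei comp_assoc; apply: zero_morphism_pre; case: kern.
have [u Eu] := kernel_lift kern zt.
by exists (j ∘ u); rewrite (comp_pre _ Ej).
Qed.

(** The kernel pair of a morphism with kernel [k] is based at its second projection, so that
    the kernel of its base map, seen through the first projection, is [k] itself. *)
Lemma normal_reflexive_graph (C : category) (X K : C) (k : hom K X) :
  pointed C -> has_pullbacks C -> is_normal k ->
  exists (R : reflexive_graph X) (k' : hom K (rg_ob R)),
    is_kernel (rg_base R) k' /\ rg_other R ∘ k' = k.
Proof.
move=> pt pullbacks [Y [f kerk]].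
have [R [r1 [r2 pb]]] := pullbacks _ _ _ f f.
have [|d [d1 d2]] := pullback_lift (a := idm X) (b := idm X) pb => //.
have [o zo] := zero_morphism_exists K X pt.
have [|k' [k1 k2]] := pullback_lift (a := k) (b := o) pb.
  by apply: zero_morphism_unique; [case: kerk | apply: zero_morphism_post].
exists (ReflexiveGraph d2 d1), k'; split=> //=.
apply: is_kernel_intro.
- by move=> T x y E; apply: (kernel_mono kerk); rewrite -k1 -!comp_assoc E.
- by rewrite k2.
- move=> T t zt; have [|u Eu] := kernel_lift (t := r1 ∘ t) kerk.
    by rewrite (comp_eq_pre _ (proj1 pb)); apply: zero_morphism_post.
  exists u; apply: (pullback_joint_mono pb); first by rewrite (comp_pre _ k1).
  rewrite (comp_pre _ k2); apply: zero_morphism_unique => //.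
  exact: zero_morphism_pre.
Qed.

(** The symmetry of the relation is an involution exchanging [r1] and [r2].  This lets the
    normalisation of [R], taken at its first projection, be computed at its second one,
    along which the pullback in the definition of Smith commutation is formed. *)
Lemma symmetric_kernel (C : category) (R X N : C) (r1 r2 : hom R X) (k : hom N R) :
  is_equivalence_relation r1 r2 -> is_kernel r1 k ->
  exists k' : hom N R, is_kernel r2 k' /\ r1 ∘ k' = r2 ∘ k.
Proof.
move=> [jm _ [s [s1 s2]] _] kerk; exists (s ∘ k).
have ss : s ∘ s = idm R.
  by apply: jm; rewrite comp_assoc ?s1 ?s2 comp_idr.
split; last by rewrite (comp_pre _ s1).
apply: is_kernel_intro.
- move=> T x y E; apply: (kernel_mono kerk).
  by rewrite -(comp_idl (k ∘ x)) -(comp_idl (k ∘ y)) -ss -!comp_assoc !(comp_assoc s k) E.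
- by rewrite (comp_pre _ s2); case: kerk.
- move=> T t zt; have [|u Eu] := kernel_lift (t := s ∘ t) kerk.
    by rewrite (comp_pre _ s1).
  by exists u; rewrite -comp_assoc Eu (comp_pre _ ss) comp_idl.
Qed.

Lemma coherent_smith_is_huq (C : category) :
  semi_abelian C -> algebraically_coherent C -> smith_is_huq C.
Proof.
move=> sab ac X R S r1 r2 s1 s2 eqR eqS N M n m [k [kerk ->]] [l [kerl ->]].
move=> [P [p1 [p2 [i1 [i2 [prodP [e11 [z21 [z12 [e22 [phi [phi1 phi2]]]]]]]]]]]].
have pullbacks := finite_limits_pullbacks (reg_limits (exact_regular (sab_exact sab))).
have [dR [dR1 dR2]] := eqrel_refl eqR; have [dS [dS1 dS2]] := eqrel_refl eqS.
have [k' [kerk' Ek']] := symmetric_kernel eqR kerk.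
have [Q [q1 [q2 pbQ]]] := pullbacks _ _ _ r2 s1.
pose GR := ReflexiveGraph dR2 dR1; pose GS := ReflexiveGraph dS1 dS2.
have [J] := @fibred_join_exists C sab ac X GR GS N M Q P k' l q1 q2 p1 p2 kerk' kerl pbQ prodP.
have [||g [gp pg]] := @fibred_join_iso C sab X GR GS N M Q P k' l q1 q2 p1 p2
  kerk' kerl pbQ prodP J i1 i2 phi e11 z21 z12 e22; first by rewrite Ek'.
  by [].
exists dR, dS, Q, q1, q2, (fj_pair J ∘ fj_left J), (fj_pair J ∘ fj_right J).
have := (fj_left1 J, fj_left2 J, fj_right1 J, fj_right2 J).
have := (fj_left_other J, fj_right_other J) => /= -[c1 c2] [[[a1 a2] b1] b2].
do 5!split=> //.
by exists (fj_other J ∘ g); rewrite -!comp_assoc !(comp_pre _ gp) !comp_idl.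
Qed.

Lemma coherent_normality_of_higgins (C : category) :
  semi_abelian C -> algebraically_coherent C -> normality_of_higgins C.
Proof.
move=> sab ac X K L k l normk norml I m.
move=> [U [i1 [i2 [P [p1 [p2 [sigma [D [iota [c H]]]]]]]]]].
move: H => [cop [prodP [[s11 s12] [[s21 s22] [keri [[c1 c2] im]]]]]].
have pt := sab_pointed sab.
have pullbacks := finite_limits_pullbacks (reg_limits (exact_regular (sab_exact sab))).
have [R [k' [kerk' Ek']]] := normal_reflexive_graph pt pullbacks normk.
have [S [l' [kerl' El']]] := normal_reflexive_graph pt pullbacks norml.
have [Q [q1 [q2 pbQ]]] := pullbacks _ _ _ (rg_base R) (rg_base S).
have [J] := fibred_join_exists sab ac kerk' kerl' pbQ prodP.
have [N [nu [n2 [pbN eqN]]]] := fibred_join_relation sab J.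
have [Y [h pbh]] := exact_effective (sab_exact sab) eqN.
have [V [v kerv]] := kernel_exists n2 pt pullbacks.
have kerh := kernel_pair_normalisation pt pbh kerv; rewrite -comp_assoc in kerh.
have [||i [j [Ei Ej]]] := relation_normalisation_higgins sab kerk' kerl' pbQ prodP
  pbN kerv cop s11 s12 s21 s22 keri (c := c) _ _ im (kernel_mono kerh).
  by rewrite Ek'.
  by rewrite El'.
exists Y, h; exact: (kernel_of_iso kerh (proj1 im) Ei Ej).
Qed.

Theorem theorem6p18 (C : category) :
  semi_abelian C -> algebraically_coherent C ->
  smith_is_huq C /\ normality_of_higgins C.
Proof.
move=> sab ac; split; first exact: coherent_smith_is_huq.
exact: coherent_normality_of_higgins.
Qed.
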